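(* Let $n\ge1$ be an integer, let $s$, $l_i$, $k_i$, $\alpha_{i,j}$ be the data attached to the binary expansion of $n$ as in the context, and put $$A=l_1+\sum_{i=1}^s\sum_{j=1}^{l_i}(k_i-j)\alpha_{i,j},\qquad l=\max_{1\le i\le s}l_i,\qquad A_j=\sum_{\substack{1\le i\le s\\ l_i\ge j}}\alpha_{i,j}.$$ Then $$\mathcal{G}(n,t)=(-1)^{\frac{n(n-1)}2}\,t^A\prod_{j=1}^l(t^j-2^j)^{A_j}.$$ In particular, the roots of $\mathcal{G}(n,t)$ are precisely $t=0$ and $t=2\zeta$, where $\zeta$ is any root of unity of order $\le l$.
   Context: For an integer $m\ge0$ with binary expansion $m=\sum_{j}\varepsilon_j2^j$, $\varepsilon_j\in\{0,1\}$, put $S(m,t)=\sum_j\varepsilon_jt^j$, and for $n\ge1$ let $\mathcal{G}(n,t)=\det[S(i+j+1,t)-S(i+j,t)]_{0\le i,j<n}$, a polynomial in $t$. For $n\ge1$ write the binary expansion (most significant digit on the left) as $$(n)_2=1^{l_s}0^{l_{s-1}}1^{l_{s-2}}\cdots\overline{a}^{\,l_3}a^{l_2}\,1\,0^{l_1},$$ where $s\ge1$, $l_1\ge0$, $l_i\ge1$ for $2\le i\le s$, $a\in\{0,1\}$, $\overline a=1-a$, and $b^m$ means the digit $b$ repeated $m$ times (so the rightmost $1$ followed by $0^{l_1}$ is separated off, and the remaining prefix, empty if $s=1$, is split into maximal alternating runs of lengths $l_s,\ldots,l_2$, the leading one consisting of $1$s). Put $k_1=l_1$, $k_i=1+\sum_{j=1}^il_j$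 for $i\ge2$; $\alpha_{i,j}=2^{k_i-j}$ if $1\le j<l_i$; and $\alpha_{1,l_1}=1$, $\alpha_{i,l_i}=2^{l_1+1}$ for $i=2,3$, $\alpha_{i,l_i}=2^{k_{i-2}+1}-\alpha_{i-1,l_{i-1}}$ for $i\ge4$. Empty products equal $1$.
   Formalization: The statement about the roots is asserted only for n ≥ 2, since for n = 1 the determinant G(1,t) = 1 has no roots and t = 0 is not a root; the product formula is kept for all n ≥ 1. *)

(* Defs.v *)
From mathcomp Require Export all_boot all_order all_algebra.

Set Implicit Arguments.
Unset Strict Implicit.
Unset Printing Implicit Defensive.

Import GRing.Theory.
Local Open Scope ring_scope.

Definition bit (m j : nat) : bool := odd (m %/ 2 ^ j)%N.

(* The bits of m of index >= m vanish, since m < 2 ^ m. *)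
Definition Spoly (m : nat) : {poly int} := \sum_(j < m | bit m j) 'X^j.

Definition Gpoly (n : nat) : {poly int} :=
  \det (\matrix_(i < n, j < n)
          (Spoly (i + j + 1)%N - Spoly (i + j)%N)).

Local Open Scope nat_scope.

(* Most significant digit first; meaningful for n >= 1, where
   trunc_log 2 n is the index of the leading digit. *)
Definition binary (n : nat) : seq bool :=
  rev (mkseq (bit n) (trunc_log 2 n).+1).

(* The word 1^(l s) 0^(l (s-1)) 1^(l (s-2)) ... of the runs s, s-1, ..., 2
   (empty if s = 1): the digit of run i is 1 iff i and s have the same parity. *)
Definition run_prefix (s : nat) (l : nat -> nat) : seq bool :=
  flatten [seq nseq (l i) (~~ odd (s - i)) | i <- rev (iota 2 (s - 1))].

(* Only the values l 1, ..., l s are constrained. *)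
Definition is_run_data (n s : nat) (l : nat -> nat) : Prop :=
  [/\ 1 <= s,
      forall i, 2 <= i <= s -> 1 <= l i
    & binary n = run_prefix s l ++ true :: nseq (l 1) false].

Definition kidx (l : nat -> nat) (i : nat) : nat :=
  if i == 1 then l 1 else 1 + \sum_(1 <= j < i.+1) l j.

(* alpha_last l i is alpha_(i, l_i), for i >= 1. For i >= 4 the subtraction is
   not truncated: alpha_(i-1, l_(i-1)) <= 2 ^ (k_(i-2) + 1), by induction. *)
Fixpoint alpha_last (l : nat -> nat) (i : nat) : nat :=
  match i with
  | 0 | 1 => 1
  | 2 | 3 => 2 ^ (l 1 + 1)
  | i'.+1 => 2 ^ (kidx l i'.-1 + 1) - alpha_last l i'
  end.

(* Used for 1 <= j <= l i only. *)
Definition alpha (l : nat -> nat) (i j : nat) : nat :=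
  if j == l i then alpha_last l i else 2 ^ (kidx l i - j).

Definition expA (s : nat) (l : nat -> nat) : nat :=
  l 1 + \sum_(1 <= i < s.+1) \sum_(1 <= j < (l i).+1) (kidx l i - j) * alpha l i j.

Definition lmax (s : nat) (l : nat -> nat) : nat := \max_(1 <= i < s.+1) l i.

Definition expAj (s : nat) (l : nat -> nat) (j : nat) : nat :=
  \sum_(1 <= i < s.+1 | j <= l i) alpha l i j.

(* Main.v *)
Require Import Defs.
From mathcomp Require Import perm zify ring fraction.
Set Implicit Arguments.
Unset Strict Implicit.
Unset Printing Implicit Defensive.
Import GRing.Theory.
Local Open Scope ring_scope.

(** Write [d m = S(m+1) - S(m)].  Splitting off the lowest binary digit gives
    [d(2m) = 1] and [d(2m+1) = t d(m) - 1], so the Hankel matrix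
    [H_n = (d(i+j))] is self-similar: after sorting rows and columns by
    parity, the equal-parity blocks are constant and the opposite-parity
    blocks have entries [t d(i+j) - 1].  Let [G n = det H_n], let [J] be the
    all-ones matrix, and let [R n] be the slope of the affine function
    [c |-> det (H_n + c J)].

    For even [n = 2m] the block matrix has the form [[A, B], [B, A]], and
    [det (A + B) det (A - B)] expresses [G n] and [R n] by [G m] and [R m].
    For odd [n = 2m+1] the determinant is, up to sign and a power of [t], the
    square of a determinant bordered by ones, which the Desnanot-Jacobi
    identity rewrites as [R(m+1) G(m) - G(m+1) R(m)].  By induction
    [R n = (2/t)^v G n] with [v] the 2-adic valuation of [n]; this eliminates
    [R].  With [P n = (-1)^C(n,2) G n] and [w j = 1 - (2/t)^j] what is left is
      [P(2m)   = t^(2m) w(v2(m) + 1) P(m)^2],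
      [P(2m+1) = t^(2m) w(v2(m(m+1))) P(m) P(m+1)]
    (lemmas [sgn_hankel_double] and [sgn_hankel_double_succ]).

    Since [2^k - m] and [m] have the same valuation, this recurrence relates
    [P (2^k - n)] to [P n] in closed form ([halving_reflect]).  On the other
    side, adding a leading run of ones to the run data of [n'] complements the
    digits of [n'] above its lowest 1; the new number is [2^k - n'], where [k] is
    the length of its binary expansion ([run_data_value]).  Hence each run [i]
    multiplies the determinant by one explicit factor, the product of the
    [t^((k_i - j) alpha_(i,j)) (t^j - 2^j)^alpha_(i,j)] over [j <= l_i], and
    the formula follows.

    The roots are read off from the factorization, because every exponent in
    it is positive when [n > 1], and [x^j = 2^j] holds exactly when [x / 2] is
    a root of unity of order dividing [j]. *)

(** * Determinants of matrices indexed by natural numbers *)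

Section NatDet.
Variable R : comNzRingType.
Implicit Types (F : nat -> nat -> R) (n : nat).

(** Entries are given by a function on [nat], so that minors, reindexed matrices
    and matrices of propositionally equal sizes need no casts. *)
Definition detn n F : R := \det (\matrix_(i < n, j < n) F i j).

Lemma eq_detn n F1 F2 :
  (forall i j, (i < n)%N -> (j < n)%N -> F1 i j = F2 i j) ->
  detn n F1 = detn n F2.
Proof. by move=> eqF; congr (\det _); apply/matrixP=> i j; rewrite !mxE eqF. Qed.

Lemma detn_tr n F : detn n (fun i j => F j i) = detn n F.
Proof. by rewrite -[RHS]det_tr; congr (\det _); apply/matrixP=> i j; rewrite !mxE. Qed.

Lemma detnZ n c F : detn n (fun i j => c * F i j) = c ^+ n * detn n F.
Proof. by rewrite -detZ; congr (\det _); apply/matrixP=> i j; rewrite !mxE. Qed.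

Lemma detn_scale_last n c F (f : nat -> R) :
  detn n.+1 (fun i j => if (j < n)%N then F i j else c * f i) =
  c * detn n.+1 (fun i j => if (j < n)%N then F i j else f i).
Proof.
pose D : 'rV[R]_n.+1 := \row_j (if (j < n)%N then 1 else c).
have detD : \det (diag_mx D) = c.
  rewrite det_diag big_ord_recr /= mxE /= ltnn big1 ?mul1r // => i _.
  by rewrite mxE /= ltn_ord.
rewrite mulrC -[X in _ = _ * X]detD -det_mulmx mul_mx_diag.
congr (\det _); apply/matrixP=> i j.
by rewrite !mxE; case: ifP => _; rewrite ?mulr1 // mulrC.
Qed.

Lemma detn_reindex n (p : nat -> nat) F :
    (forall i, (i < n)%N -> (p i < n)%N) ->
    (forall i j, (i < n)%N -> (j < n)%N -> p i = p j -> i = j) ->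
  detn n (fun i j => F (p i) (p j)) = detn n F.
Proof.
move=> p_lt p_inj.
pose f (i : 'I_n) := Ordinal (p_lt i (ltn_ord i)).
have f_inj : injective f by move=> i j [/p_inj] /(_ (ltn_ord i) (ltn_ord j)) /val_inj.
pose s := perm f_inj.
have -> : detn n (fun i j => F (p i) (p j)) =
          \det (row_perm s (col_perm s (\matrix_(i < n, j < n) F i j))).
  by congr (\det _); apply/matrixP=> i j; rewrite !mxE !permE.
rewrite row_permE col_permE !det_mulmx !det_perm odd_permV.
by rewrite mulrCA -signr_addb addbb mulr1.
Qed.

Definition parity_sort a i := if (i < a)%N then i.*2 else (i - a).*2.+1.

Lemma detn_parity a b F : (b <= a <= b.+1)%N ->
  detn (a + b) F =
  \det (block_mx (\matrix_(i < a, j < a) F i.*2 j.*2)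
                 (\matrix_(i < a, j < b) F i.*2 j.*2.+1)
                 (\matrix_(i < b, j < a) F i.*2.+1 j.*2)
                 (\matrix_(i < b, j < b) F i.*2.+1 j.*2.+1)).
Proof.
move=> /andP[ba ab]; have p_lt i : (i < a + b -> parity_sort a i < a + b)%N.
  by rewrite /parity_sort; case: (ltnP i a) => ?; lia.
have p_inj i j : (i < a + b -> j < a + b ->
    parity_sort a i = parity_sort a j -> i = j)%N.
  by rewrite /parity_sort; case: (ltnP i a) => ?; case: (ltnP j a) => ?; lia.
rewrite -(detn_reindex _ p_lt p_inj).
congr (\det _); apply/matrixP=> i j; rewrite /parity_sort.
case: (split_ordP i) => i' ->; case: (split_ordP j) => j' ->;
  by rewrite ?(block_mxEul, block_mxEur, block_mxEdl, block_mxEdr) !mxE /=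
     ?ltn_ord ?(ltnNge _ a) ?leq_addr ?addKn.
Qed.

(** Adding the second block row to the first, then subtracting the first block
    column from the second, makes the matrix block triangular. *)
Lemma det_block_circulant n (A B : 'M[R]_n) :
  \det (block_mx A B B A) = \det (A + B) * \det (A - B).
Proof.
have dU : \det (block_mx 1%:M 1%:M 0 1%:M : 'M[R]_(n + n)) = 1.
  by rewrite det_ublock !det1 mulr1.
have dV : \det (block_mx 1%:M (- 1%:M) 0 1%:M : 'M[R]_(n + n)) = 1.
  by rewrite det_ublock !det1 mulr1.
rewrite -(det_lblock (A + B) B) -[LHS]mul1r -[X in X * _ = _]dU.
rewrite -[LHS]mulr1 -[X in _ * X = _]dV -!det_mulmx.
congr (\det _); rewrite !mulmx_block.
rewrite !(mul1mx, mul0mx, mulmx1, mulmx0, mulmxN, addr0, add0r).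
by rewrite (addrC B) addNr (addrC (- B)).
Qed.

(** Write [K] for the square matrix [(C | 1)].  The constant upper left block
    and [C] both factor through [K] on the left, and [K^T] with its last row
    scaled by [x] reappears on the right.  So the matrix is
    [diag(K, 1) S U] where [U] is block triangular and [S] is the permutation
    matrix exchanging the first [m] and the last [m] indices, whose determinant
    is [(-1)^m]. *)
Lemma det_block_const m (x y : R) (C : 'M[R]_(m + 1, m)) :
  \det (block_mx (const_mx x) C C^T (const_mx y)) =
  (-1) ^+ m * x * \det (row_mx C (const_mx 1)) ^+ 2.
Proof.
set K := row_mx C (const_mx 1).
pose A : 'M[R]_(m + 1) := block_mx 0 0 0 1%:M.
pose B : 'M[R]_(m + 1, m) := col_mx 1%:M 0.
pose B' : 'M[R]_(m, m + 1) := row_mx 1%:M 0.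
pose S := block_mx A B B' 0.
pose L : 'M[R]_(m + 1) := col_mx C^T (const_mx x).
have dS : \det S = (-1) ^+ m.
  have ABB : A + B *m B' = 1%:M.
    rewrite /A /B /B' mul_col_row !(mulmx0, mul0mx, mulmx1) add_block_mx.
    by rewrite !(addr0, add0r) -scalar_mx_block.
  have dU : \det (block_mx 1%:M B 0 1%:M : 'M[R]_(m + 1 + m)) = 1.
    by rewrite det_ublock !det1 mulr1.
  have dL : \det (block_mx 1%:M 0 (- B') 1%:M : 'M[R]_(m + 1 + m)) = 1.
    by rewrite det_lblock !det1 mulr1.
  rewrite -[LHS]mul1r -[X in X * _ = _]dU -det_mulmx.
  rewrite -[LHS]mul1r -[X in X * _ = _]dL -det_mulmx /S.
  rewrite !mulmx_block !(mul1mx, mul0mx, mulmx1, mulmx0, addr0, add0r) ABB.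
  rewrite !mulmx1 addNr det_ublock det1 mul1r mulNmx mul_row_col mul1mx mulmx0 addr0.
  by rewrite -scaleN1r detZ det1 mulr1.
have dL : \det L = x * \det K.
  rewrite -(det_tr K) tr_row_mx trmx_const.
  rewrite /L -[x * _]mul1r.
  have -> : col_mx C^T (const_mx x) =
      block_mx 1%:M 0 0 x%:M *m col_mx C^T (const_mx 1) :> 'M_(m + 1).
    rewrite mul_block_col !mul0mx mul1mx addr0 add0r; congr col_mx.
    by apply/matrixP=> i j; rewrite mul_scalar_mx !mxE mulr1.
  by rewrite det_mulmx det_ublock det1 det_scalar1 mul1r mul1r.
have -> : block_mx (const_mx x) C C^T (const_mx y) =
   block_mx K 0 0 1%:M *m (S *m block_mx L (col_mx (const_mx y) 0) 0 1%:M).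
  rewrite /S !mulmx_block !(mul1mx, mul0mx, mulmx1, mulmx0, addr0, add0r).
  have AL : A *m L = col_mx 0 (const_mx x).
    by rewrite /A /L mul_block_col !mul0mx mul1mx !add0r.
  have AB0 : A *m col_mx (const_mx y) 0 = 0 :> 'M_(m + 1, m).
    by rewrite /A mul_block_col !mul0mx mulmx0 !addr0 col_mx0.
  rewrite AL AB0 add0r /K /B /B' !mul_row_col.
  rewrite !(mul1mx, mul0mx, mulmx1, mulmx0, addr0, add0r).
  congr block_mx; apply/matrixP=> i j; rewrite !mxE big_ord1 !mxE mul1r //.
rewrite !det_mulmx dS !det_ublock !det1 dL; ring.
Qed.

Definition border n F i j : R :=
  if (i < n)%N then (if (j < n)%N then F i j else 1)
  else (if (j < n)%N then -1 else 0).

(** A multiple of the all-ones matrix is a rank one perturbation.  Eliminating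
    with the corner entry 1 turns a matrix bordered by a column of ones and a
    row of [-c] into [F + c], and the bordered determinant is linear in its last
    row [(-c, ..., -c, 1)]. *)
Lemma detn_addc n F (c : R) :
  detn n (fun i j => F i j + c) = detn n F + c * detn n.+1 (border n F).
Proof.
pose H := \matrix_(i < n, j < n) F i j.
pose M (a b : R) : 'M[R]_(n + 1) :=
  block_mx H (const_mx 1) (const_mx (- a)) (const_mx b).
have M0 b : \det (M 0 b) = b * \det H.
  rewrite /M oppr0 det_ublock mulrC; congr (_ * _).
  by rewrite det_mx11 mxE.
have bM : detn n.+1 (border n F) = \det (M 1 0).
  rewrite -addn1; congr (\det _); apply/matrixP=> i j; rewrite /M /border.
  case: (split_ordP i) => i' ->; case: (split_ordP j) => j' ->;
  by rewrite ?(block_mxEul, block_mxEur, block_mxEdl, block_mxEdr) !mxE /=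
     ?ltn_ord ?ltnNge ?leq_addr.
have Mc : \det (M c 1) = detn n (fun i j => F i j + c).
  have dU : \det (block_mx 1%:M 0 (const_mx c) 1%:M : 'M[R]_(n + 1)) = 1.
    by rewrite det_lblock !det1 mulr1.
  rewrite -[LHS]mulr1 -[X in _ * X = _]dU -det_mulmx /M.
  rewrite mulmx_block !(mulmx0, mulmx1, add0r).
  have -> : const_mx (- c) + (const_mx 1 : 'M[R]_1) *m const_mx c = 0 :> 'M[R]_(1, n).
    by apply/matrixP=> i j; rewrite !mxE big_ord1 !mxE mul1r addNr.
  rewrite det_ublock (det_mx11 (const_mx 1)) mxE mulr1; congr (\det _).
  by apply/matrixP=> i j; rewrite !mxE big_ord1 !mxE mul1r.
rewrite -Mc bM.
have row'M a b : row' (rshift n ord0) (M a b) = row' (rshift n ord0) (M c 1).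
  apply/matrixP=> k j; rewrite !mxE.
  case: (splitP (lift _ _)) => k' ek; first by rewrite !mxE.
  have /eqP[] := neq_lift (rshift n ord0) k.
  by apply/val_inj; rewrite [RHS]ek (ord1 k').
rewrite (@determinant_multilinear _ _ (M c 1) (M 0 1) (M 1 0) (rshift n ord0) 1 c).
- by rewrite M0 !mul1r.
- apply/rowP=> j; rewrite !mxE.
  have -> : split (rshift n ord0) = inr (ord0 : 'I_1) := unsplitK (inr ord0).
  by rewrite !mxE; case: (split j) => k; rewrite !mxE; ring.
- exact: row'M.
- exact: row'M.
Qed.

End NatDet.

Section Condensation.
Variable K : fieldType.
Implicit Types (F : nat -> nat -> K) (m : nat).

Lemma det_schur m p (A : 'M[K]_m) B C (D : 'M_p) : A \in unitmx ->
  \det (block_mx A B C D) = \det A * \det (D - C *m invmx A *m B).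
Proof.
move=> uA.
have dL : \det (block_mx 1%:M 0 (- (C *m invmx A)) 1%:M : 'M[K]_(m + p)) = 1.
  by rewrite det_lblock !det1 mulr1.
rewrite -[LHS]mul1r -[X in X * _ = _]dL -det_mulmx mulmx_block.
rewrite !(mul1mx, mul0mx, addr0, add0r) !mulNmx mulmxKV // addNr det_ublock.
by rewrite (addrC D).
Qed.

Lemma det_mx22 (M : 'M[K]_2) : \det M = M 0 0 * M 1 1 - M 0 1 * M 1 0.
Proof.
rewrite (expand_det_row _ ord0) !big_ord_recl big_ord0 addr0 /cofactor !det_mx11 !mxE /=.
have -> : lift ord0 0 = 1 :> 'I_2 by apply/val_inj.
have -> : lift 1 0 = 0 :> 'I_2 by apply/val_inj.
by rewrite expr0 expr1 mul1r mulN1r mulrN.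
Qed.

Definition skip m i := if (i < m)%N then i else i.+1.

(** By Schur complements with respect to the leading minor, each of the four
    minors of size [m + 1] is [detn m F] times an entry of the 2 x 2 Schur
    complement, and [detn m.+2 F] is [detn m F] times its determinant. *)
Lemma desnanot_jacobi m F : detn m F != 0 ->
  detn m.+2 F * detn m F =
    detn m.+1 F * detn m.+1 (fun i j => F (skip m i) (skip m j))
  - detn m.+1 (fun i j => F i (skip m j)) * detn m.+1 (fun i j => F (skip m i) j).
Proof.
move=> nzF.
pose A := \matrix_(i < m, j < m) F i j.
have uA : A \in unitmx by rewrite unitmxE unitfE.
pose B := \matrix_(i < m, j < 2) F i (m + j)%N.
pose C := \matrix_(i < 2, j < m) F (m + i)%N j.
pose D := \matrix_(i < 2, j < 2) F (m + i)%N (m + j)%N.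
pose S := D - C *m invmx A *m B.
have minor (a b : 'I_2) :
    detn m.+1 (fun i j => F (if (i < m)%N then i else m + a)%N
                            (if (j < m)%N then j else m + b)%N) =
    detn m F * S a b.
  have -> : S a b = \det ((D a b)%:M - row a C *m invmx A *m col b B).
    rewrite det_mx11 !mxE eqxx mulr1n.
    congr (_ - _); apply: eq_bigr=> k _; rewrite !mxE; congr (_ * _).
    by apply: eq_bigr=> j _; rewrite !mxE.
  rewrite -(det_schur _ _ _ uA) -addn1; congr (\det _); apply/matrixP=> i j.
  case: (split_ordP i) => i' ->; case: (split_ordP j) => j' ->;
  by rewrite ?(block_mxEul, block_mxEur, block_mxEdl, block_mxEdr) !mxE /=
     ?ltn_ord ?(ltnNge _ m) ?leq_addr ?ord1 ?mulr1n.
have minorE a b G : (forall i j, (i < m.+1)%N -> (j < m.+1)%N ->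
     G i j = F (if (i < m)%N then i else m + a)%N
               (if (j < m)%N then j else m + b)%N) ->
   (a < 2)%N -> (b < 2)%N -> detn m.+1 G = detn m F * S (inord a) (inord b).
  move=> eG a2 b2; rewrite -minor.
  by apply: eq_detn => i j im jm; rewrite eG // !inordK.
have -> : detn m.+2 F = detn m F * \det S.
  rewrite -(det_schur _ _ _ uA) -addn2; congr (\det _); apply/matrixP=> i j.
  by case: (split_ordP i) => i' ->; case: (split_ordP j) => j' ->;
    rewrite ?(block_mxEul, block_mxEur, block_mxEdl, block_mxEdr) !mxE.
have lowE i : (i < m.+1)%N -> (if (i < m)%N then i else m + 0)%N = i.
  by case: (ltnP i m); lia.
have skipE i : (i < m.+1)%N -> skip m i = (if (i < m)%N then i else m + 1)%N.
  by rewrite /skip; case: (ltnP i m); lia.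
rewrite (minorE 0%N 0%N F) //; last first.
  by move=> i j im jm; rewrite ?skipE ?lowE.
rewrite (minorE 1%N 1%N) //; last first.
  by move=> i j im jm; rewrite ?skipE ?lowE.
rewrite (minorE 0%N 1%N) //; last first.
  by move=> i j im jm; rewrite ?skipE ?lowE.
rewrite (minorE 1%N 0%N) //; last first.
  by move=> i j im jm; rewrite ?skipE ?lowE.
have -> : inord 0 = 0 :> 'I_2 by apply/val_inj; rewrite /= inordK.
have -> : inord 1 = 1 :> 'I_2 by apply/val_inj; rewrite /= inordK.
rewrite det_mx22; ring.
Qed.

End Condensation.

(** * Self-similar Hankel determinants *)

Section SelfSimilarHankel.
Variables (K : fieldType) (t : K) (d : nat -> K).
Hypotheses (t_neq0 : t != 0) (d_even : forall m, d m.*2 = 1).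
Hypothesis (d_odd : forall m, d m.*2.+1 = t * d m - 1).

Let D i j := d (i + j).
Definition hankel n := detn n D.
(** The slope of [c |-> det (H_n + c J)], see [detn_addc]. *)
Definition hankel_ones n := detn n.+1 (border n D).
Definition hankel_bordered n :=
  detn n.+1 (fun i j => if (j < n)%N then D i j else 1).

Local Notation G := hankel.
Local Notation R := hankel_ones.
Local Notation L := hankel_bordered.

Lemma hankel_affine m c :
  detn m (fun i j => t * D i j + c) = t ^+ m * (G m + c / t * R m).
Proof.
rewrite -detn_addc -detnZ; apply: eq_detn => i j _ _.
by rewrite mulrDr mulrCA mulfV // mulr1.
Qed.

(** The four parity blocks form [[A, B], [B, A]] with [A] constant equal to
    [1 + c] and [B = t H + (c - 1)], so [A + B = t H + 2 c] and
    [A - B = - (t H - 2)]. *)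
Lemma hankel_double_addc m c :
  detn (m + m) (fun i j => D i j + c) =
  (t ^+ m * (G m + 2 * c / t * R m)) * ((- t) ^+ m * (G m - 2 / t * R m)).
Proof.
rewrite detn_parity ?leqnn ?leqnSn //.
pose A : 'M[K]_m := const_mx (1 + c).
pose B := \matrix_(i < m, j < m) (t * D i j + (c - 1)).
have -> : forall M1 M2 M3 M4 : 'M[K]_m, M1 = A -> M2 = B -> M3 = B -> M4 = A ->
    \det (block_mx M1 M2 M3 M4) = \det (A + B) * \det (A - B).
  by move=> _ _ _ _ -> -> -> ->; apply: det_block_circulant.
- congr (_ * _).
    rewrite -hankel_affine; congr (\det _); apply/matrixP=> i j; rewrite !mxE; ring.
  have -> : A - B = - 1 *: (\matrix_(i < m, j < m) (t * D i j + - 2)).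
    by apply/matrixP=> i j; rewrite !mxE; ring.
  rewrite detZ [\det _]hankel_affine mulrA -exprMn mulN1r; congr (_ * (_ + _)).
  by rewrite !mulNr.
- by apply/matrixP=> i j; rewrite !mxE /D -doubleD d_even.
- by apply/matrixP=> i j; rewrite !mxE /D addnS -doubleD d_odd; ring.
- by apply/matrixP=> i j; rewrite !mxE /D addSn -doubleD d_odd; ring.
- by apply/matrixP=> i j; rewrite !mxE /D addSn addnS -doubleD -doubleS d_even.
Qed.

(** Both diagonal parity blocks are constant, and in the bordered matrix the
    constant part of the off-diagonal block is removed by column operations with
    the column of ones. *)
Lemma hankel_double_succ_addc m c :
  detn (m + 1 + m) (fun i j => D i j + c) =
  (1 + c) * ((- 1) ^+ m * t ^+ m.*2 * L m ^+ 2).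
Proof.
rewrite detn_parity ?addn1 ?leqnn ?leqnSn // -addn1.
pose C := \matrix_(i < m + 1, j < m) (t * D i j + (c - 1)).
have -> : forall M1 M2 M3 M4, M1 = const_mx (1 + c) -> M2 = C -> M3 = C^T ->
    M4 = const_mx (1 + c) ->
    \det (block_mx M1 M2 M3 M4) =
    (- 1) ^+ m * (1 + c) * \det (row_mx C (const_mx 1)) ^+ 2.
  by move=> _ _ _ _ -> -> -> ->; apply: det_block_const.
- have -> : \det (row_mx C (const_mx 1)) = t ^+ m * L m.
    pose E := \matrix_(i < m + 1, j < m) D i j.
    have -> : row_mx C (const_mx 1) =
        row_mx E (const_mx 1) *m
        block_mx t%:M 0 (const_mx (c - 1)) 1%:M :> 'M_(m + 1).
      rewrite mul_row_block mulmx0 add0r mulmx1; congr row_mx.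
      rewrite mul_mx_scalar; apply/matrixP=> i j.
      by rewrite !mxE big_ord1 !mxE mul1r.
    rewrite det_mulmx det_lblock det1 det_scalar mulr1 mulrC; congr (_ * _).
    rewrite /L -[in RHS]addn1; congr (\det _); apply/matrixP=> i j; rewrite !mxE.
    by case: (splitP j) => k jk; rewrite !mxE ?jk.
  rewrite exprMn -exprM muln2; ring.
- by apply/matrixP=> i j; rewrite !mxE /D -doubleD d_even.
- by apply/matrixP=> i j; rewrite !mxE /D addnS -doubleD d_odd; ring.
- by apply/matrixP=> i j; rewrite !mxE /D addSn -doubleD addnC d_odd; ring.
- by apply/matrixP=> i j; rewrite !mxE /D addSn addnS -doubleD -doubleS d_even.
Qed.

(** Desnanot-Jacobi for [H_(m+1)] bordered by ones: the two off-diagonal minors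
    are both [hankel_bordered m] up to sign, by symmetry of [H]. *)
Lemma hankel_bordered_sqr m : G m != 0 -> L m ^+ 2 = R m.+1 * G m - G m.+1 * R m.
Proof.
move=> Gm.
pose E := border m.+1 D.
have EG : detn m E = G m.
  by apply: eq_detn => i j im jm; rewrite /E /border !(leq_trans _ (leqnSn m)).
have EG1 : detn m.+1 E = G m.+1.
  by apply: eq_detn => i j im jm; rewrite /E /border im jm.
have := @desnanot_jacobi _ m E; rewrite EG EG1 => /(_ Gm) ->.
have skip_lt i : (i < m.+1)%N -> (skip m i < m.+1)%N = (i < m)%N.
  by rewrite /skip; case: (ltnP i m); lia.
have skip_id i : (i < m)%N -> skip m i = i by rewrite /skip => ->.
have -> : detn m.+1 (fun i j => E (skip m i) (skip m j)) = R m.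
  apply: eq_detn => i j im jm; rewrite /E /border !skip_lt //.
  by do 2 case: ltnP => ? //; rewrite ?skip_id.
have -> : detn m.+1 (fun i j => E i (skip m j)) = L m.
  apply: eq_detn => i j im jm; rewrite /E /border !skip_lt // im.
  by case: ltnP => ? //; rewrite ?skip_id.
have -> : detn m.+1 (fun i j => E (skip m i) j) = - L m.
  rewrite -detn_tr -mulN1r -detn_scale_last; apply: eq_detn => i j im jm.
  rewrite /E /border im skip_lt //.
  by case: ltnP => ?; rewrite ?mulr1 // skip_id // /D addnC.
ring.
Qed.

Let r := 2 / t.

Let G_R_addc n c : G n + c * R n = detn n (fun i j => D i j + c).
Proof. by rewrite detn_addc. Qed.

Lemma hankel_double m :
  G (m + m) = t ^+ m * G m * ((- t) ^+ m * (G m - r * R m)) /\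
  R (m + m) = t ^+ m * (r * R m) * ((- t) ^+ m * (G m - r * R m)).
Proof.
have eG c : G (m + m) + c * R (m + m) =
   t ^+ m * (G m + c * (r * R m)) * ((- t) ^+ m * (G m - r * R m)).
  rewrite G_R_addc hankel_double_addc /r; ring.
have G0 := eG 0; rewrite !mul0r !addr0 in G0; split=> //.
by apply: (addrI (G (m + m))); rewrite -[X in _ + X]mul1r eG G0; ring.
Qed.

Lemma hankel_double_succ m :
  G (m + 1 + m) = (- 1) ^+ m * t ^+ m.*2 * L m ^+ 2 /\
  R (m + 1 + m) = (- 1) ^+ m * t ^+ m.*2 * L m ^+ 2.
Proof.
have eG c : G (m + 1 + m) + c * R (m + 1 + m) =
   (1 + c) * ((- 1) ^+ m * t ^+ m.*2 * L m ^+ 2).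
  by rewrite G_R_addc hankel_double_succ_addc.
have G0 := eG 0; rewrite !mul0r !addr0 mul1r in G0; split=> //.
by apply: (addrI (G (m + 1 + m))); rewrite -[X in _ + X]mul1r eG G0; ring.
Qed.

Hypothesis r_generic : forall j, (0 < j)%N -> r ^+ j != 1.

(** One of [m], [m + 1] is odd, so one of the two powers of [r] is 1 and the
    other has exponent [logn 2 (m * m.+1)]; the parity of [m] decides the sign. *)
Lemma hankel_bordered_ratio m : (0 < m)%N -> G m != 0 ->
    R m = r ^+ logn 2 m * G m -> R m.+1 = r ^+ logn 2 m.+1 * G m.+1 ->
  L m ^+ 2 = (- 1) ^+ m * (1 - r ^+ logn 2 (m * m.+1)) * (G m * G m.+1).
Proof.
move=> m_gt0 Gm Rm Rm1; rewrite hankel_bordered_sqr // Rm Rm1 lognM // -signr_odd.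
have [o | e] := boolP (odd m).
  by rewrite [logn 2 m]lognE dvdn2 o /= andbF add0n !expr0 expr1; ring.
by rewrite [logn 2 m.+1]lognE dvdn2 /= e /= addn0 !expr0; ring.
Qed.

(** Doubling multiplies the ratio [R n / G n] by [r], and the ratio is 1 for odd
    [n].  The nonvanishing of [G] is proved along with it because the odd step
    divides by a smaller [G] in Desnanot-Jacobi. *)
Lemma hankel_ones_ratio n : (0 < n)%N -> G n != 0 /\ R n = r ^+ logn 2 n * G n.
Proof.
elim/ltn_ind: n => n IHn n_gt0.
have [o | e] := boolP (odd n); last first.
  have en : n = (n./2 + n./2)%N by rewrite addnn halfK (negbTE e) subn0.
  have m_gt0 : (0 < n./2)%N by lia.
  have m_lt : (n./2 < n)%N by lia.
  have [] := IHn _ m_lt m_gt0; move: (n./2) en m_gt0 => m -> m_gt0 Gm Rm.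
  have [-> ->] := hankel_double m.
  have w : G m - r * R m != 0.
    rewrite Rm mulrA -exprS -[X in X - _]mul1r -mulrBl mulf_neq0 // subr_eq0.
    by rewrite eq_sym r_generic.
  have -> : logn 2 (m + m) = (logn 2 m).+1 by rewrite addnn -mul2n lognM.
  split; last by rewrite Rm exprS; ring.
  by rewrite !mulf_neq0 ?expf_neq0 ?oppr_eq0.
have en : n = (n./2 + 1 + n./2)%N by lia.
have -> : logn 2 n = 0%N by rewrite lognE dvdn2 o /= andbF.
have [] := hankel_double_succ n./2; rewrite -en => -> ->; rewrite mul1r; split=> //.
suff L2 : L n./2 ^+ 2 != 0.
  by rewrite mulf_neq0 ?L2 ?mulf_neq0 ?signr_eq0 // expf_neq0.
have [-> | m_gt0] := posnP n./2.
  by rewrite expf_neq0 // /L /detn det_mx11 mxE oner_eq0.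
have [Gm Rm] := IHn n./2 ltac:(lia) m_gt0.
have [Gm1 Rm1] := IHn n./2.+1 ltac:(lia) isT.
rewrite hankel_bordered_ratio // !mulf_neq0 ?signr_eq0 //.
rewrite subr_eq0 eq_sym r_generic // logn_gt0 mem_primes /= muln_gt0 m_gt0 /=.
by rewrite dvdn2 oddM /=; case: (odd _).
Qed.

(** The sign [(-1)^'C(n, 2)] absorbs all signs in the two recurrences. *)
Definition sgn_hankel n := (- 1) ^+ 'C(n, 2) * G n.
Local Notation P := sgn_hankel.

Lemma sgn_hankel1 : P 1 = 1.
Proof. by rewrite /P expr0 mul1r /G /detn det_mx11 mxE; apply: (d_even 0). Qed.

Lemma sgn_hankel_double m : (0 < m)%N ->
  P m.*2 = t ^+ m.*2 * (1 - r ^+ (logn 2 m).+1) * P m ^+ 2.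
Proof.
move=> m_gt0; have [_ Rm] := hankel_ones_ratio m_gt0.
have -> : P m ^+ 2 = G m ^+ 2 by rewrite /P exprMn sqrr_sign mul1r.
rewrite /P -[in LHS]addnn (hankel_double m).1 Rm.
have -> : (-1) ^+ 'C(m + m, 2) = (-1) ^+ m :> K.
  rewrite -signr_odd -[RHS]signr_odd bin2 addnn -doubleMl doubleK oddM.
  by case: m m_gt0 {Rm} => //= m _; rewrite odd_double andbT.
rewrite (exprNn t) exprS -addnn exprD.
have s2 : (-1) ^+ m * (-1) ^+ m = 1 :> K by rewrite -expr2 sqrr_sign.
ring: s2.
Qed.

Lemma sgn_hankel_double_succ m : (0 < m)%N ->
  P m.*2.+1 = t ^+ m.*2 * (1 - r ^+ logn 2 (m * m.+1)) * (P m * P m.+1).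
Proof.
move=> m_gt0; have [Gm Rm] := hankel_ones_ratio m_gt0.
have [_ Rm1] := hankel_ones_ratio (ltn0Sn m).
have em : m.*2.+1 = (m + 1 + m)%N by rewrite addn1 -addnn.
have s3 : (-1) ^+ 'C(m, 2) * (-1) ^+ 'C(m.+1, 2) = (-1) ^+ m :> K.
  by rewrite binS bin1 exprD mulrA -expr2 sqrr_sign mul1r.
have -> : P m * P m.+1 = (-1) ^+ m * (G m * G m.+1) by rewrite /P mulrACA s3.
rewrite /P [in G _]em (hankel_double_succ m).1 hankel_bordered_ratio //.
have -> : (-1) ^+ 'C(m.*2.+1, 2) = (-1) ^+ m :> K.
  by rewrite -signr_odd -[RHS]signr_odd bin2 /= -doubleMr doubleK oddM /= odd_double.
have s2 : (-1) ^+ m * (-1) ^+ m = 1 :> K by rewrite -expr2 sqrr_sign.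
ring: s2.
Qed.

End SelfSimilarHankel.

(** * Decoding the run lengths *)

Section RunData.
Local Open Scope nat_scope.

(** Least significant digit first. *)
Definition value_of_bits (s : seq bool) : nat :=
  foldr (fun (b : bool) a => b + a.*2) 0 s.

Lemma value_of_bits_cat s1 s2 :
  value_of_bits (s1 ++ s2) = value_of_bits s1 + 2 ^ size s1 * value_of_bits s2.
Proof.
elim: s1 => [|b s1 IHs] /=; first by rewrite mul1n.
by rewrite IHs expnS; lia.
Qed.

Lemma value_of_bits_nseq k (b : bool) : value_of_bits (nseq k b) = b * (2 ^ k - 1).
Proof.
elim: k => [|k IHk] /=; first by rewrite muln0.
have : 0 < 2 ^ k by rewrite expn_gt0.
by rewrite IHk expnS; case: b {IHk}; lia.
Qed.

Lemma value_of_bits_mkseq n k : value_of_bits (mkseq (bit n) k) = n %% 2 ^ k.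
Proof.
elim: k => [|k IHk]; first by rewrite modn1.
rewrite mkseqS -cats1 value_of_bits_cat IHk size_mkseq /= addn0 /bit.
have r_lt : n %% 2 ^ k < 2 ^ k by rewrite ltn_mod expn_gt0.
have := divn_eq (n %/ 2 ^ k) 2; rewrite modn2; have := divn_eq n (2 ^ k).
move: (n %% 2 ^ k) (n %/ 2 ^ k) r_lt => r q r_lt -> eq.
rewrite {2}eq mulnDl -mulnA -expnS -addnA modnMDl modn_small.
  by case: (odd q); lia.
by rewrite expnS; case: (odd q); lia.
Qed.

Lemma value_of_binary n : value_of_bits (rev (binary n)) = n.
Proof.
by rewrite /binary revK value_of_bits_mkseq modn_small // trunc_log_ltn.
Qed.

(** The length of the binary expansion formed by the runs 1, ..., i, including
    the separate digit 1; it is [k_i] except that [runs_end l 1 = k_1 + 1]. *)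
Definition runs_end (l : nat -> nat) i := 1 + \sum_(1 <= j < i.+1) l j.

(** For [i >= 1], the number whose run lengths are [l 1, ..., l i].  The value
    at 0 is chosen so that the recursion also yields [run_value l 1 = 2 ^ l 1]. *)
Fixpoint run_value (l : nat -> nat) i :=
  if i is i'.+1 then 2 ^ runs_end l i - run_value l i' else 2 ^ l 1.

Section Runs.
Variable l : nat -> nat.
Local Notation K := (runs_end l).
Local Notation N := (run_value l).

Lemma runs_endS i : K i.+1 = K i + l i.+1.
Proof. by rewrite /runs_end big_nat_recr //= addnA. Qed.

Lemma run_value1 : N 1 = 2 ^ l 1.
Proof. by rewrite /= /runs_end big_nat1 expnS; lia. Qed.

Lemma run_value_le i : N i <= 2 ^ K i.+1.
Proof.
case: i => [|i]; first by rewrite /= leq_exp2l // /runs_end big_nat1 leqnSn.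
rewrite (leq_trans (leq_subr _ _)) // leq_exp2l // (runs_endS i.+1); exact: leq_addr.
Qed.

Lemma run_value_bounds i : (forall j, 2 <= j <= i -> 1 <= l j) -> 0 < i ->
  2 ^ K i <= (N i).*2 <= 2 ^ (K i).+1.
Proof.
case: i => // i; elim: i => [|i IHi] l_gt0 _.
  by rewrite run_value1 /runs_end big_nat1 add1n !expnS; lia.
have /andP[_] := IHi (fun j jb => l_gt0 j ltac:(lia)) isT.
have : 2 ^ (K i.+1).+1 <= 2 ^ K i.+2.
  have l_pos : 0 < l i.+2 by apply: l_gt0; rewrite leqnn.
  by rewrite leq_exp2l // (runs_endS i.+1); lia.
by rewrite [N i.+2]/= !(expnS 2 (K _)); lia.
Qed.

(** The exceptional exponents are twice the numbers formed by two runs fewer: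
    this is where the recursion defining [alpha_last] comes from. *)
Lemma alpha_lastE i : alpha_last l i.+2 = (N i).*2.
Proof.
elim: i => [|i IHi]; first by rewrite /= addn1 expnS mul2n.
case: i IHi => [|i] IHi; first by rewrite run_value1 /= addn1 expnS mul2n.
rewrite [LHS](_ : _ = 2 ^ (kidx l i.+2 + 1) - alpha_last l i.+3) // IHi.
by rewrite [N i.+2]/= doubleB addn1 expnS mul2n.
Qed.

Lemma kidxE i : 1 < i -> kidx l i = K i.
Proof. by rewrite /kidx; case: eqP => // ->. Qed.

Lemma sum_exp2 k d : d <= k ->
  \sum_(1 <= j < d.+1) 2 ^ (k - j) = 2 ^ k - 2 ^ (k - d).
Proof.
elim: d => [|d IHd] dk; first by rewrite big_geq // subn0 subnn.
rewrite big_nat_recr //= IHd ?(ltnW dk) //.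
have -> : k - d = (k - d.+1).+1 by lia.
have : 2 ^ (k - d.+1).+1 <= 2 ^ k by rewrite leq_exp2l //; lia.
by rewrite expnS; lia.
Qed.

Lemma alpha_before_last i j : j < l i -> alpha l i j = 2 ^ (kidx l i - j).
Proof. by rewrite /alpha => ji; rewrite ltn_eqF. Qed.

Lemma alpha1 j : j <= l 1 -> alpha l 1 j = 2 ^ (l 1 - j).
Proof. by rewrite /alpha; case: eqP => // -> _; rewrite subnn. Qed.

Lemma sum_alpha1 : \sum_(1 <= j < (l 1).+1) alpha l 1 j = 2 ^ l 1 - 1.
Proof.
have := sum_exp2 (leqnn (l 1)); rewrite subnn => <-.
by apply: eq_big_nat => j /andP[_ jl]; rewrite alpha1.
Qed.

Lemma sum_alphaS i : 0 < i -> 0 < l i.+1 ->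
  \sum_(1 <= j < (l i.+1).+1) alpha l i.+1 j = 2 ^ K i.+1 - (N i).*2.
Proof.
case: i => // i _ l_gt0; rewrite big_nat_recr //=.
rewrite [alpha _ _ (l _)]/alpha eqxx alpha_lastE.
have -> : \sum_(1 <= j < l i.+2) alpha l i.+2 j = 2 ^ K i.+2 - 2 ^ (K i.+1).+1.
  have -> : (K i.+1).+1 = K i.+2 - (l i.+2).-1 by rewrite (runs_endS i.+1); lia.
  rewrite -sum_exp2 ?prednK //; last by rewrite runs_endS; lia.
  by apply: eq_big_nat => j /andP[_ jl]; rewrite alpha_before_last // kidxE.
have : 2 ^ (K i.+1).+1 <= 2 ^ K i.+2 by rewrite leq_exp2l // (runs_endS i.+1); lia.
have := run_value_le i.
by rewrite !(expnS 2 (K i.+1)); lia.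
Qed.

(** The digits of the first [s] runs, least significant first; [c] fixes which
    parity of run index carries the digit 1, so that the word for [s.+1] extends
    the word for [s]. *)
Definition run_word s c :=
  nseq (l 1) false ++ true ::
  flatten [seq nseq (l i) (c (+) odd i) | i <- iota 2 (s - 1)].

Lemma run_wordS s c : 0 < s ->
  run_word s.+1 c = run_word s c ++ nseq (l s.+1) (c (+) odd s.+1).
Proof.
case: s => // s _; rewrite /run_word !subn1 [s.+2.-1]/= -[in LHS](addn1 s) iotaD.
by rewrite map_cat flatten_cat /= cats0 -catA /= add2n.
Qed.

Lemma size_run_word s c : 0 < s -> size (run_word s c) = K s.
Proof.
case: s => // s _; elim: s => [|s IHs].
  by rewrite size_cat size_nseq /= /runs_end big_nat1 addn1.
by rewrite run_wordS // size_cat IHs size_nseq -runs_endS.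
Qed.

(** If the top run consists of zeros, the value is that of the runs below it.
    If it consists of ones, it adds [2 ^ runs_end l s - 2 ^ runs_end l s.-1] to
    the value of a word whose top run consists of zeros. *)
Lemma value_of_run_word s c : 0 < s ->
  value_of_bits (run_word s c) = if c (+) odd s then N s else N s.-1.
Proof.
case: s => // s _; elim: s => [|s IHs].
  rewrite value_of_bits_cat value_of_bits_nseq size_nseq run_value1 /= mul0n muln1.
  by case: ifP.
rewrite run_wordS // value_of_bits_cat IHs value_of_bits_nseq size_run_word //.
rewrite [odd s.+2]/= addbN; case: (_ (+) _) => /=; first by rewrite muln0 addn0.
have := run_value_le s.
have : 2 ^ K s.+1 <= 2 ^ K s.+2 by rewrite leq_exp2l // (runs_endS s.+1) leq_addr.
have : 0 < 2 ^ l s.+2 by rewrite expn_gt0.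
rewrite mul1n (runs_endS s.+1) expnD.
nia.
Qed.

Lemma run_data_value n s : is_run_data n s l -> n = N s.
Proof.
case=> s_gt0 _ def_n; rewrite -[LHS]value_of_binary def_n.
have -> : rev (run_prefix s l ++ true :: nseq (l 1) false) = run_word s (~~ odd s).
  rewrite rev_cat rev_cons rev_nseq -cats1 -catA; congr (_ ++ _ :: _).
  rewrite /run_prefix map_rev rev_flatten map_rev revK -map_comp; congr flatten.
  apply/eq_in_map => i; rewrite mem_iota /= rev_nseq => ib.
  by rewrite oddB ?addNb //; lia.
by rewrite value_of_run_word // addNb addbb.
Qed.

End Runs.

End RunData.

(** * Solving the recurrence along the runs *)

Lemma logn2_sub_exp k m : (0 < m < 2 ^ k)%N -> logn 2 (2 ^ k - m) = logn 2 m.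
Proof.
case/andP=> m_gt0 m_lt.
have [//|q oq em] := @pfactor_coprime 2 m _ m_gt0.
have vk : (logn 2 m < k)%N.
  rewrite -(@ltn_exp2l 2) //; apply: leq_ltn_trans m_lt.
  by rewrite dvdn_leq // pfactor_dvdnn.
move: (logn 2 m) em vk => v em vk; subst m.
have -> : (2 ^ k - q * 2 ^ v = (2 ^ (k - v) - q) * 2 ^ v)%N.
  by rewrite mulnBl -expnD subnK // ltnW.
rewrite coprime2n in oq.
have q_lt : (q < 2 ^ (k - v))%N.
  by rewrite -(ltn_pmul2r (expn_gt0 2 v)) -expnD subnK // ltnW.
have oq' : odd (2 ^ (k - v) - q).
  by rewrite oddB ?(ltnW q_lt) // oq oddX subn_eq0 leqNgt vk.
rewrite lognM ?expn_gt0 ?subn_gt0 // pfactorK //.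
by rewrite lognE dvdn2 oq' andbF.
Qed.

(** Here [P] stands for the signed determinants and [w j] for [1 - (2/t)^j]; the
    recurrence alone determines [P] at the numbers built from runs. *)
Section HalvingRecurrence.
Variables (K : comNzRingType) (t : K) (w : nat -> K) (P : nat -> K).
Hypothesis P_one : P 1 = 1.
Hypothesis P_double : forall m, (0 < m)%N ->
  P m.*2 = t ^+ m.*2 * w (logn 2 m).+1 * P m ^+ 2.
Hypothesis P_double_succ : forall m, (0 < m)%N ->
  P m.*2.+1 = t ^+ m.*2 * w (logn 2 (m * m.+1)) * (P m * P m.+1).

Lemma prod_exp2S k d : (d <= k.+1)%N ->
  \prod_(1 <= j < d) w j ^+ (2 ^ (k.+1 - j)) =
  (\prod_(1 <= j < d) w j ^+ (2 ^ (k - j))) ^+ 2.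
Proof.
move=> dk; rewrite -prodrXl; apply: eq_big_nat => j /andP[_ jd].
by rewrite -exprM -expnSr subSn // -ltnS (leq_trans jd).
Qed.

Lemma halving_exp2 d :
  P (2 ^ d) = t ^+ (d * 2 ^ d) * \prod_(1 <= j < d.+1) w j ^+ (2 ^ (d - j)).
Proof.
elim: d => [|d IHd]; first by rewrite P_one big_geq // mulr1.
rewrite expnS mul2n P_double ?expn_gt0 // IHd pfactorK // [in RHS]big_nat_recr //=.
rewrite subnn expr1 prod_exp2S // exprMn -exprM.
have -> : (d.+1 * (2 ^ d).*2 = (2 ^ d).*2 + d * 2 ^ d * 2)%N by lia.
rewrite exprD; ring.
Qed.

(** The case [n = 1] of the reflection formula: the end of the descent, since
    halving 1 would lead to 0, at which the recurrence says nothing. *)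
Lemma halving_exp2_pred d : (0 < d)%N ->
  P (2 ^ d - 1) =
  t ^+ (d * (2 ^ d - 2)) * \prod_(1 <= j < d) w j ^+ (2 ^ (d - j)).
Proof.
case: d => // d _; elim: d => [|d IHd]; first by rewrite P_one big_geq // mulr1.
have e2 : (2 < 2 ^ d.+2)%N by rewrite (ltn_exp2l 1).
have -> : (2 ^ d.+2 - 1 = (2 ^ d.+1 - 1).*2.+1)%N by rewrite [in LHS]expnS; lia.
have e1 : (1 < 2 ^ d.+1)%N by rewrite (ltn_exp2l 0).
rewrite P_double_succ ?subn_gt0 // IHd subn1 prednK ?(ltnW e1) // halving_exp2.
rewrite lognM ?expn_gt0 //; last by lia.
rewrite pfactorK // [logn 2 _.-1]lognE dvdn2 -subn1 oddB ?(ltnW e1) // oddX andbF.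
rewrite add0n [in RHS]big_nat_recr //= [in RHS]prod_exp2S //.
have -> : (d.+2 * (2 ^ d.+2 - 2) =
  (2 ^ d.+1 - 1).*2 + d.+1 * (2 ^ d.+1 - 2) + d.+1 * 2 ^ d.+1)%N.
  rewrite [(2 ^ d.+2)%N]expnS; nia.
rewrite !exprD [\prod_(1 <= j < d.+2) _]big_nat_recr //= subnn expr1.
have -> : (d.+2 - d.+1 = 1)%N by lia.
rewrite expn1; ring.
Qed.

(** Induction on [e] by halving [n]: the condition says [2^(e-1) <= n <= 2^e], and
    an interval whose closedness and dyadic ends let the halves of [n], rounded
    down and up, satisfy it at [e - 1] as long as [n > 1].  The recurrence has the
    same valuations at [2^(e+d) - n] as at [n], so it introduces equal [w] factors
    on the two sides, and only the discrepancy at [n = 1] is propagated. *)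
Lemma halving_reflect e d n : (0 < d)%N -> (2 ^ e <= n.*2 <= 2 ^ e.+1)%N ->
  P (2 ^ (e + d) - n) =
  P n * t ^+ ((e + d) * (2 ^ (e + d) - n.*2)) *
  (\prod_(1 <= j < d) w j ^+ (2 ^ (e + d - j))) * w d ^+ (2 ^ e - n).*2.
Proof.
move=> d_gt0; elim: e n => [|e IHe] n /andP[le_n n_le].
  have -> : n = 1%N by move: le_n n_le; rewrite expn0 expn1; lia.
  by rewrite P_one mul1r halving_exp2_pred // mulr1.
have [n_le1 | n_gt1] := leqP n 1.
  have e0 : e = 0%N.
    by apply/eqP; rewrite -leqn0 -ltnS -(@leq_exp2l 2) //; lia.
  have -> : n = 1%N by move: le_n; rewrite e0; lia.
  rewrite e0 add1n P_one mul1r halving_exp2_pred // big_nat_recr //= mulrA.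
  by rewrite subSnn.
have E_even : (0 < e)%N -> ~~ odd (2 ^ e) by case: (e) => // k _; rewrite oddX.
have E_1 : e = 0%N -> (2 ^ e = 1)%N by move=> ->.
rewrite addSn expnS mul2n.
have eX : (2 ^ e.+1 <= 2 ^ (e + d))%N by rewrite leq_exp2l //; lia.
have e_gt0 : (0 < 2 ^ e)%N by rewrite expn_gt0.
rewrite prod_exp2S; last by lia.
rewrite (expnS 2 e) in eX le_n; rewrite (expnS 2 e.+1) (expnS 2 e) in n_le.
rewrite (expnS 2 e) in IHe *.
set E := (2 ^ e)%N in E_even E_1 e_gt0 eX le_n n_le IHe *.
have logX m : (0 < m < 2 ^ (e + d))%N -> logn 2 (2 ^ (e + d) - m) = logn 2 m.
  exact: logn2_sub_exp.
move: (2 ^ (e + d))%N eX logX IHe => X eX logX IHe.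
move: (\prod_(1 <= j < d) _) IHe => Q IHe.
have [o | ev] := boolP (odd n); last first.
  have en : n = n./2.*2 by rewrite halfK (negbTE ev) subn0.
  move: (n./2) en => m en; subst n.
  have -> : (X.*2 - m.*2 = (X - m).*2)%N by rewrite doubleB.
  rewrite !P_double ?logX ?IHe; try lia.
  have -> : ((2 * E - m.*2).*2 = (E - m).*2 * 2)%N by lia.
  rewrite [w d ^+ (_ * 2)]exprM.
  have regroup a b c f (x p u v : K) : a * b ^+ 2 = c * f ->
      a * x * (p * b * u * v) ^+ 2 = c * x * p ^+ 2 * f * u ^+ 2 * v ^+ 2.
    move=> eab; transitivity ((a * b ^+ 2) * (x * (p * u * v) ^+ 2)); first by ring.
    by rewrite eab; ring.
  apply: regroup.
  rewrite -exprM -!exprD; congr (_ ^+ _).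
  have -> : X = (X - m.*2 + m.*2)%N by lia.
  move: (X - m.*2)%N => Y; nia.
have en : n = n./2.*2.+1 by lia.
move: (n./2) en => m en; subst n.
have -> : (X.*2 - m.*2.+1 = (X - m.+1).*2.+1)%N by lia.
rewrite !P_double_succ ?logX; try lia.
have -> : (X - m.+1).+1 = (X - m)%N by lia.
rewrite !lognM ?logX; try lia.
(* [E] is 1 or even, so [E <= 2m + 1] and [0 < m] give [E <= 2m]. *)
have E_le : (E <= m.*2)%N by case: (posnP e) => [/E_1|/E_even]; lia.
rewrite !IHe; try lia.
have -> : ((2 * E - m.*2.+1).*2 = (E - m).*2 + (E - m.+1).*2)%N by lia.
have regroup a b b' c f (x p p' u v v' : K) : a * (b' * b) = c * f ->
    a * x * (p' * b' * u * v' * (p * b * u * v)) =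
    c * x * (p * p') * f * u ^+ 2 * (v * v').
  move=> eab; transitivity ((a * (b' * b)) * (x * (p * p') * u ^+ 2 * (v * v'))).
    by ring.
  by rewrite eab; ring.
rewrite exprD [(logn 2 m + _)%N]addnC; apply: regroup.
rewrite -!exprD; congr (_ ^+ _).
have -> : X = (X - m.+1.*2 + m.+1.*2)%N by lia.
move: (X - m.+1.*2)%N => Y; nia.
Qed.

(** Distributes the power of [t] so that each [w j] becomes [t^j w j], which is
    [t^j - 2^j] in the application. *)
Lemma prod_homogenize k d (a : nat -> nat) : (d <= k)%N ->
  t ^+ (k * \sum_(1 <= j < d.+1) a j) * \prod_(1 <= j < d.+1) w j ^+ a j =
  \prod_(1 <= j < d.+1) (t ^+ ((k - j) * a j) * (t ^+ j * w j) ^+ a j).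
Proof.
move=> dk; rewrite big_distrr expr_sum -big_split; apply: eq_big_nat => j /andP[_ jd].
have jk : (j <= k)%N by lia.
by rewrite exprMn -exprM mulrA -exprD -mulnDl subnK.
Qed.

(** Run [s] contributes one reflection, from [run_value l s.-1] to
    [2 ^ runs_end l s - run_value l s.-1]. *)
Lemma halving_run_value (l : nat -> nat) s :
    (1 <= s)%N -> (forall i, (2 <= i <= s)%N -> (1 <= l i)%N) ->
  P (run_value l s) = t ^+ l 1 * \prod_(1 <= i < s.+1) \prod_(1 <= j < (l i).+1)
     (t ^+ ((kidx l i - j) * alpha l i j) * (t ^+ j * w j) ^+ alpha l i j).
Proof.
case: s => // s _; elim: s => [|s IHs] l_gt0.
  rewrite run_value1 halving_exp2 big_nat1 -prod_homogenize // sum_alpha1.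
  rewrite mulrA -exprD -mulnS subn1 prednK ?expn_gt0 //; congr (_ * _).
  by apply: eq_big_nat => j /andP[_ jl]; rewrite alpha1.
rewrite big_nat_recr //= mulrA -IHs; last by move=> i ib; apply: l_gt0; lia.
have ls_gt0 : (0 < l s.+2)%N by apply: l_gt0; rewrite leqnn.
have kE : runs_end l s.+2 = (runs_end l s.+1 + l s.+2)%N by rewrite runs_endS.
rewrite -[P (_ - _)%N]/(P (2 ^ runs_end l s.+2 - run_value l s.+1)) kE.
rewrite (halving_reflect ls_gt0); last first.
  by apply: run_value_bounds => // j jb; apply: l_gt0; lia.
rewrite -kE -prod_homogenize ?kidxE //; last by rewrite kE leq_addl.
rewrite sum_alphaS // -!mulrA; congr (_ * (_ * _)).
rewrite [in RHS]big_nat_recr //=; congr (_ * _ ^+ _).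
  by apply: eq_big_nat => j /andP[_ jl]; rewrite alpha_before_last // kidxE.
rewrite /alpha eqxx alpha_lastE; have := run_value_le l s.
lia.
Qed.

End HalvingRecurrence.

Lemma collect_run_exponents (K : comNzRingType) (t : K) (l : nat -> nat) s
    (b : nat -> K) :
  t ^+ l 1 * \prod_(1 <= i < s.+1) \prod_(1 <= j < (l i).+1)
     (t ^+ ((kidx l i - j) * alpha l i j) * b j ^+ alpha l i j) =
  t ^+ expA s l * \prod_(1 <= j < (lmax s l).+1) b j ^+ expAj s l j.
Proof.
under eq_bigr do rewrite big_split -expr_sum /=.
rewrite big_split -expr_sum mulrA -exprD; congr (_ * _).
rewrite (eq_big_nat _ _ (F2 := fun i =>
  \prod_(1 <= j < (lmax s l).+1 | (j <= l i)%N) b j ^+ alpha l i j)) /=.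
  rewrite (exchange_big_dep_nat xpredT) //=.
  by apply: eq_bigr => j _; rewrite /expAj expr_sum.
move=> i ib; rewrite (big_nat_widen _ _ (lmax s l).+1) //= ltnS /lmax.
by rewrite (@leq_bigmax_seq _ _ _ l) // mem_index_iota.
Qed.

(** * Differences of binary digit polynomials *)

(** The digits of index at least [n] vanish. *)
Lemma Spoly_widen n k : (n <= k)%N -> Spoly n = \sum_(0 <= j < k | bit n j) 'X^j.
Proof.
move=> nk; rewrite /Spoly -(big_mkord (bit n) (fun j => 'X^j)) (big_nat_widen _ _ k) //.
apply: eq_bigl => j.
case: (ltnP j n) => [_|nj]; first by rewrite andbT.
by rewrite andbF /bit divn_small // (leq_ltn_trans nj) // ltn_expl.
Qed.

Lemma Spoly_double (b : bool) m : Spoly (b + m.*2) = b%:R + 'X * Spoly m.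
Proof.
have bit0 : bit (b + m.*2) 0 = b.
  by rewrite /bit divn1 oddD odd_double addbF oddb.
have bitS j : bit (b + m.*2) j.+1 = bit m j.
  rewrite /bit expnS divnMA; congr (odd (_ %/ _)).
  by rewrite divn2 half_bit_double.
rewrite (@Spoly_widen m (b + m.*2)); last by lia.
rewrite (Spoly_widen (leqnSn _)) big_mkcond big_nat_recl // bit0 -big_mkcond /=.
congr (_ + _); first by case: (b).
rewrite big_distrr [RHS]big_mkcond [LHS]big_mkcond; apply: eq_bigr => j _ /=.
by rewrite bitS exprS.
Qed.

Definition Sdiff m : {poly int} := Spoly m.+1 - Spoly m.

Lemma Sdiff_even m : Sdiff m.*2 = 1.
Proof.
rewrite /Sdiff (Spoly_double true m) (Spoly_double false m) add0r.
by rewrite addrK.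
Qed.

Lemma Sdiff_odd m : Sdiff m.*2.+1 = 'X * Sdiff m - 1.
Proof.
rewrite /Sdiff (Spoly_double true m) -doubleS (Spoly_double false m.+1) add0r.
by rewrite mulrBr opprD addrA addrAC.
Qed.

Lemma GpolyE n : Gpoly n = detn n (fun i j => Sdiff (i + j)).
Proof.
by congr (\det _); apply/matrixP => i j; rewrite !mxE addn1.
Qed.

(** The recurrences divide by [t] and by determinants, so they are solved in a
    field containing the polynomials and pulled back. *)
Lemma Gpoly_prod_embed (F : fieldType) (f : {rmorphism {poly int} -> F}) n s l :
    injective f -> is_run_data n s l ->
  Gpoly n = (-1) ^+ ((n * (n - 1)) %/ 2) * 'X^(expA s l) *
        \prod_(1 <= j < (lmax s l).+1) ('X^j - (2 ^+ j)%:P) ^+ expAj s l j.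
Proof.
move=> f_inj hl; have [s_gt0 l_gt0 _] := hl; have def_n := run_data_value hl.
have f_neq0 p : p != 0 -> f p != 0 by rewrite -(inj_eq f_inj) rmorph0.
pose t := f 'X; pose d m := f (Sdiff m).
have t0 : t != 0 by rewrite f_neq0 ?polyX_eq0.
have d_even m : d m.*2 = 1 by rewrite /d Sdiff_even rmorph1.
have d_odd m : d m.*2.+1 = t * d m - 1.
  by rewrite /d Sdiff_odd rmorphB rmorphM rmorph1.
have XnE j : f ('X^j - (2 ^+ j)%:P) = t ^+ j * (1 - (2 / t) ^+ j).
  rewrite rmorphB polyC_exp !rmorphXn /= polyC_natr rmorph_nat -/t mulrBr mulr1.
  by rewrite expr_div_n mulrCA mulfV ?mulr1 // expf_neq0.
have gen j : (0 < j)%N -> (2 / t) ^+ j != 1.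
  move=> j_gt0; have : f ('X^j - (2 ^+ j)%:P) != 0.
    by rewrite f_neq0 // -size_poly_eq0 size_XnsubC.
  by rewrite XnE mulf_eq0 negb_or [_ - _ == 0]subr_eq0 [1 == _]eq_sym => /andP[].
pose w j := 1 - (2 / t) ^+ j.
have := @halving_run_value F t w (sgn_hankel d) (sgn_hankel1 d_even)
  (sgn_hankel_double t0 d_even d_odd gen)
  (sgn_hankel_double_succ t0 d_even d_odd gen) l s s_gt0 l_gt0.
rewrite (collect_run_exponents t l s (fun j => t ^+ j * w j)) -def_n /sgn_hankel => eP.
apply: f_inj.
have -> : f (Gpoly n) = hankel d n.
  rewrite GpolyE /hankel /detn -det_map_mx; congr (\det _).
  by apply/matrixP => i j; rewrite !mxE.
rewrite -mulrA 2!rmorphM rmorph_sign rmorphXn rmorph_prod.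
have -> : (n * (n - 1) %/ 2 = 'C(n, 2))%N by rewrite bin2 divn2 subn1.
under eq_bigr do rewrite rmorphXn /= XnE.
by rewrite -eP mulrA -expr2 sqrr_sign mul1r.
Qed.

Lemma Gpoly_prod n s l : is_run_data n s l ->
  Gpoly n = (-1) ^+ ((n * (n - 1)) %/ 2) * 'X^(expA s l) *
        \prod_(1 <= j < (lmax s l).+1) ('X^j - (2 ^+ j)%:P) ^+ expAj s l j.
Proof.
apply: (@Gpoly_prod_embed _ (@tofrac {poly int})).
by move=> p q /eqP; rewrite tofrac_eq => /eqP.
Qed.

Lemma alpha_gt0 s l n i j :
    is_run_data n s l -> (1 <= i <= s)%N -> (1 <= j <= l i)%N ->
  (0 < alpha l i j)%N.
Proof.
case=> _ l_gt0 _ /andP[i_gt0 i_le] /andP[j_gt0 j_le].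
rewrite /alpha; case: eqP => [_|_]; last by rewrite expn_gt0.
case: i i_gt0 i_le {j_le} => [|[|i]] // _ i_le.
rewrite alpha_lastE double_gt0.
case: i i_le => [|i] i_le; first by rewrite expn_gt0.
have := @run_value_bounds l i.+1 (fun k kb => l_gt0 k ltac:(lia)) isT.
by have : (0 < 2 ^ runs_end l i.+1)%N by [rewrite expn_gt0]; lia.
Qed.

Lemma expAj_gt0 s l n j : is_run_data n s l -> (1 <= j <= lmax s l)%N ->
  (0 < expAj s l j)%N.
Proof.
move=> hl /andP[j_gt0 j_le].
have [i ib ij] : exists2 i, (1 <= i <= s)%N & (j <= l i)%N.
  case: (boolP (has (fun i => j <= l i)%N (index_iota 1 s.+1))) => [/hasP[i]|].
    by rewrite mem_index_iota ltnS => ib ij; exists i.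
  move=> /hasPn none; suff : (lmax s l <= j.-1)%N by lia.
  by apply/bigmax_leqP_seq => i ii _; have := none i ii; lia.
rewrite /expAj (big_rem i) /=; last by rewrite mem_index_iota ltnS.
by rewrite ij addn_gt0 (alpha_gt0 hl) // j_gt0.
Qed.

Lemma expA_gt0 s l n : (1 < n)%N -> is_run_data n s l -> (0 < expA s l)%N.
Proof.
move=> n_gt1 hl; have [s_gt0 l_gt0 _] := hl.
rewrite /expA addn_gt0; case: posnP => //= l1.
have s_gt1 : (1 < s)%N.
  case: s s_gt0 hl {l_gt0} => [|[|s]] // _ /run_data_value.
  by rewrite run_value1 l1 => en; rewrite en in n_gt1.
rewrite (big_rem 2) /=; last by rewrite mem_index_iota ltnS.
have l2 : (0 < l 2)%N by rewrite l_gt0 // s_gt1.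
rewrite addn_gt0; apply/orP; left.
rewrite (big_rem 1) /=; last by rewrite mem_index_iota ltnS l2.
rewrite addn_gt0 muln_gt0 (alpha_gt0 hl) ?s_gt1 // andbT kidxE //.
rewrite runs_endS /runs_end big_nat1 l1 addKn; apply/orP; left; exact: l2.
Qed.

Theorem corollary3p10 (n s : nat) (l : nat -> nat)
    (hn : (1 <= n)%N) (hl : is_run_data n s l) :
  Gpoly n = (-1) ^+ ((n * (n - 1)) %/ 2) * 'X^(expA s l) *
        \prod_(1 <= j < (lmax s l).+1) ('X^j - (2 ^+ j)%:P) ^+ expAj s l j
  /\
  ((1 < n)%N -> forall (C : numClosedFieldType) (x : C),
     root (map_poly intr (Gpoly n)) x <->
     x = 0 \/
     exists (m : nat) (z : C),
       [/\ (1 <= m <= lmax s l)%N, m.-primitive_root z & x = 2 * z]).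
Proof.
have GE := Gpoly_prod hl; split=> // n_gt1 C x.
have two_neq0 : 2 != 0 :> C by rewrite Num.Theory.pnatr_eq0.
have rootE : root (map_poly intr (Gpoly n)) x =
    (x == 0) || has (fun j => x ^+ j == 2 ^+ j) (index_iota 1 (lmax s l).+1).
  rewrite rootE GE !rmorphM rmorph_sign rmorphXn rmorph_prod /= map_polyX.
  rewrite !hornerM hornerXn horner_prod horner_exp hornerN hornerC.
  rewrite !mulf_eq0 signr_eq0 expf_eq0 (expA_gt0 n_gt1 hl) prodf_seq_eq0 /=.
  congr (_ || _); apply: eq_in_has => j; rewrite mem_index_iota ltnS => jb.
  rewrite rmorphXn rmorphB /= map_polyXn map_polyC horner_exp !hornerE.
  by rewrite expf_eq0 (expAj_gt0 hl jb) subr_eq0 /= rmorphXn.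
rewrite rootE; split=> [/orP[/eqP->|/hasP[j]]|].
- by left.
- rewrite mem_index_iota ltnS => /andP[j_gt0 j_le] /eqP xj; right.
  have zj : (x / 2) ^+ j = 1 by rewrite expr_div_n xj mulfV // expf_neq0.
  have [m z_prim m_dvd] := prim_order_exists j_gt0 zj.
  exists m, (x / 2); split=> //; last by rewrite mulrC divfK.
  by rewrite (prim_order_gt0 z_prim) (leq_trans (dvdn_leq j_gt0 m_dvd)).
- case=> [->|[m [z [mb z_prim ->]]]]; first by rewrite eqxx.
  apply/orP; right; apply/hasP; exists m; first by rewrite mem_index_iota ltnS.
  by rewrite exprMn (prim_expr_order z_prim) mulr1.
Qed.
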